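(* Let $G$ be a finite group and let $P_1,\ldots,P_n$ ($n\ge 1$) be a choice of Sylow subgroups of $G$, one for each prime dividing $|G|$. Let $\underline{M}$ be a cohomological $G$-Mackey functor. Then there is an isomorphism of abelian groups $$\underline{M}(G/G)\cong\Big(\bigoplus_{i=1}^n\underline{M}(G/P_i)\Big)/\!\sim,$$ where $\sim$ is the (additive) equivalence relation generated by $$\mathrm{Tr}_H^{P_i}(x)\sim\mathrm{Tr}_{H'}^{P_j}(c_g x)$$ for all $i,j\in\{1,\ldots,n\}$, all subgroups $H\le P_i$, all $x\in\underline{M}(G/H)$ and all $g\in G$ with $H'=gHg^{-1}\le P_j$. Here $\mathrm{Tr}_H^{P_i}(x)$ is regarded as an element of the $i$-th summand and $\mathrm{Tr}_{H'}^{P_j}(c_gx)$ as an element of the $j$-th summand, so the right-hand side is the quotient by the subgroup generated by all differences $\mathrm{Tr}_H^{P_i}(x)-\mathrm{Tr}_{H'}^{P_j}(c_gx)$.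
   Context: A $G$-Mackey functor $\underline{M}$ is an additive functor from the category of spans of finite $G$-sets to abelian groups. Equivalently, it consists of abelian groups $\underline{M}(G/H)$ for $H\le G$ with restriction maps $R^H_K:\underline{M}(G/H)\to\underline{M}(G/K)$ and transfer maps $\mathrm{Tr}_K^H:\underline{M}(G/K)\to\underline{M}(G/H)$ for $K\le H\le G$, and conjugation isomorphisms $c_g:\underline{M}(G/H)\to\underline{M}(G/gHg^{-1})$ for $g\in G$, satisfying the usual identities (functoriality, compatibility with conjugation, $c_g=\mathrm{id}$ on $\underline{M}(G/H)$ for $g\in H$, and the double coset formula). $\underline{M}$ is cohomological if $\mathrm{Tr}_K^H\circ R^H_K$ is multiplication by the index $[H:K]=|H|/|K|$ for all $K\le H\le G$. *)

(* Defs.v *)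
From HB Require Import structures.
From mathcomp Require Import all_boot all_order all_algebra all_fingroup all_solvable.
From mathcomp Require Import ring_quotient boolp.

Set Implicit Arguments.
Unset Strict Implicit.
Unset Printing Implicit Defensive.

Import GRing.Theory.

Local Open Scope ring_scope.

(* Finite direct sums are realized as products; the library only provides an
   additive structure on non-dependent finite functions. *)
Definition dsum (I : finType) (T : I -> zmodType) : Type :=
  {dffun forall i, T i}.

Section DirectSum.
Variables (I : finType) (T : I -> zmodType).

HB.instance Definition _ := Choice.on (dsum T).

Definition dsum0 : dsum T := [ffun i => 0 : T i].
Definition dsumN (u : dsum T) : dsum T := [ffun i => - u i].
Definition dsumD (u v : dsum T) : dsum T := [ffun i => u i + v i].

Fact dsum_addA : associative dsumD.
Proof. by move=> u v w; apply/ffunP=> i; rewrite !ffunE addrA. Qed.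
Fact dsum_addC : commutative dsumD.
Proof. by move=> u v; apply/ffunP=> i; rewrite !ffunE addrC. Qed.
Fact dsum_add0 : left_id dsum0 dsumD.
Proof. by move=> u; apply/ffunP=> i; rewrite !ffunE add0r. Qed.
Fact dsum_addN : left_inverse dsum0 dsumN dsumD.
Proof. by move=> u; apply/ffunP=> i; rewrite !ffunE addNr. Qed.

HB.instance Definition _ :=
  GRing.isZmodule.Build (dsum T) dsum_addA dsum_addC dsum_add0 dsum_addN.

Definition dsum_in (i : I) (x : T i) : dsum T :=
  [ffun j => dfwith (fun k => 0 : T k) x j].

End DirectSum.

Inductive subgroup_gen (V : zmodType) (S : V -> Prop) : V -> Prop :=
| subgroup_gen_in v : S v -> subgroup_gen S v
| subgroup_gen0 : subgroup_gen S 0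
| subgroup_genB u v :
    subgroup_gen S u -> subgroup_gen S v -> subgroup_gen S (u - v).

(* Library quotients are taken by boolean predicates, hence the classical
   [asbool]. *)
Definition in_subgroup_gen (V : zmodType) (S : V -> Prop) : {pred V} :=
  fun v => `[< subgroup_gen S v >].

Fact in_subgroup_gen_closed (V : zmodType) (S : V -> Prop) :
  zmod_closed (in_subgroup_gen S).
Proof.
split=> [|u v /asboolP Su /asboolP Sv]; apply/asboolP.
  exact: subgroup_gen0.
exact: subgroup_genB.
Qed.

HB.instance Definition _ (V : zmodType) (S : V -> Prop) :=
  GRing.isZmodClosed.Build V (in_subgroup_gen S) (in_subgroup_gen_closed S).

Definition quot_gen (V : zmodType) (S : V -> Prop) : zmodType :=
  Quotient.quot (in_subgroup_gen S).

(* The double cosets KgL for g in H. *)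
Definition dcosets (gT : finGroupType) (K L H : {group gT}) : {set {set gT}} :=
  [set (K :* g * L)%g | g in H].

(* [M H] stands for M(G/H), [mres M H K] for R^H_K, [mtr M K H] for Tr_K^H and
   [mconj M g H K] for c_g : M(G/H) -> M(G/K) where K = gHg^-1; having K as a
   separate argument avoids transports along equalities of subgroups. Only the
   values for subgroups of G with K \subset H (resp. K = gHg^-1 with g \in G)
   are meaningful, the others are unconstrained. Recall that H :^ g denotes
   g^-1Hg, so that gHg^-1 is H :^ g^-1. *)
Record mackeyFunctor (gT : finGroupType) (G : {group gT}) := MackeyFunctor {
  mval :> {group gT} -> zmodType;
  mres : forall H K : {group gT}, {additive mval H -> mval K};
  mtr : forall K H : {group gT}, {additive mval K -> mval H};
  mconj : forall (g : gT) (H K : {group gT}), {additive mval H -> mval K};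
  mres_id : forall H : {group gT}, H \subset G ->
    forall x, mres H H x = x;
  mtr_id : forall H : {group gT}, H \subset G ->
    forall x, mtr H H x = x;
  mconj_id : forall (g : gT) (H : {group gT}), H \subset G -> g \in H ->
    forall x, mconj g H H x = x;
  mres_comp : forall L K H : {group gT},
    L \subset K -> K \subset H -> H \subset G ->
    forall x, mres K L (mres H K x) = mres H L x;
  mtr_comp : forall L K H : {group gT},
    L \subset K -> K \subset H -> H \subset G ->
    forall x, mtr K H (mtr L K x) = mtr L H x;
  mconj_comp : forall (g h : gT) (H K L : {group gT}),
    H \subset G -> g \in G -> h \in G ->
    K :=: (H :^ g^-1)%g -> L :=: (K :^ h^-1)%g ->
    forall x, mconj h K L (mconj g H K x) = mconj (h * g)%g H L x;
  mconj_res : forall (g : gT) (K H K' H' : {group gT}),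
    K \subset H -> H \subset G -> g \in G ->
    K' :=: (K :^ g^-1)%g -> H' :=: (H :^ g^-1)%g ->
    forall x, mconj g K K' (mres H K x) = mres H' K' (mconj g H H' x);
  mconj_tr : forall (g : gT) (K H K' H' : {group gT}),
    K \subset H -> H \subset G -> g \in G ->
    K' :=: (K :^ g^-1)%g -> H' :=: (H :^ g^-1)%g ->
    forall x, mconj g H H' (mtr K H x) = mtr K' H' (mconj g K K' x);
  mdouble_coset : forall (K L H : {group gT}) (X : {set gT}),
    K \subset H -> L \subset H -> H \subset G ->
    is_transversal X (dcosets K L H) H ->
    forall x, mres H K (mtr L H x) =
      \sum_(g in X)
        mtr (K :&: L :^ g^-1)%G K
          (mconj g (K :^ g :&: L)%G (K :&: L :^ g^-1)%G
            (mres L (K :^ g :&: L)%G x))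
}.

Definition cohomological (gT : finGroupType) (G : {group gT})
    (M : mackeyFunctor G) : Prop :=
  forall K H : {group gT}, K \subset H -> H \subset G ->
  forall x : M H, mtr M K H (mres M H K x) = x *+ #|H : K|%g.

(* The generators Tr_H^{P_i}(x) - Tr_{H'}^{P_j}(c_g x), H' = gHg^-1. *)
Definition tr_conj_diff (gT : finGroupType) (G : {group gT})
    (M : mackeyFunctor G) (n : nat) (P : 'I_n -> {group gT})
    (d : dsum (fun i => M (P i))) : Prop :=
  exists (i j : 'I_n) (H H' : {group gT}) (g : gT) (x : M H),
    [/\ H \subset P i, g \in G, H' :=: (H :^ g^-1)%g, H' \subset P j
      & d = dsum_in (T := fun i => M (P i)) (mtr M H (P i) x)
            - dsum_in (T := fun i => M (P i))
                (mtr M H' (P j) (mconj M g H H' x))].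

(* Main.v *)
(* Let Phi be the sum of the transfers M(G/P_i) -> M(G/G). It kills the
   relations, since c_g is the identity on M(G/G). The indices [G : P_i] have
   gcd 1, so sum_i a_i [G : P_i] = 1 for some integers a_i. The map Psi sending
   y to the family of the a_i R^G_{P_i} y is inverse to Phi modulo the relations:
   Phi Psi = id because M is cohomological. For x in M(G/P_j), the double coset
   formula for R^G_{P_i} Tr_{P_j}^G x, followed by the relations, turns its
   summand at P_i g P_j into Tr R x = [P_j : P_i^g :&: P_j] x, placed in the
   j-th summand. These indices add up to [G : P_i], whence Psi Phi x ~ x. *)
Require Import Defs.
From HB Require Import structures.
From mathcomp Require Import all_boot all_order all_algebra all_fingroup all_solvable.
From mathcomp Require Import ring_quotient boolp.

Set Implicit Arguments.
Unset Strict Implicit.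
Unset Printing Implicit Defensive.

Import GRing.Theory.

(** * Counting double cosets *)

Section DoubleCosets.
Variables (gT : finGroupType) (K L H : {group gT}).
Local Open Scope group_scope.

Lemma dcoset_eqP (x y : gT) : y \in K :* x * L -> K :* y * L = K :* x * L.
Proof.
case/mulsgP=> _ l /rcosetP[k Kk ->] Ll ->.
by rewrite 2!rcosetM (rcoset_id Kk) -mulgA [[set l] * L]lcoset_id.
Qed.

Lemma mem_dcoset_id (x : gT) : x \in K :* x * L.
Proof. by rewrite -[x in x \in _]mulg1 mem_mulg ?rcoset_refl. Qed.

Lemma dcosets_partition :
  K \subset H -> L \subset H -> partition (dcosets K L H) H.
Proof.
move=> sKH sLH; apply/and3P; split.
- apply/eqP/setP=> x; apply/bigcupP/idP=> [[_ /imsetP[g Hg ->]]|Hx].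
    apply/subsetP; rewrite mul_subG // mul_subG ?sub1set //.
  by exists (K :* x * L); [apply: imset_f | apply: mem_dcoset_id].
- apply/trivIsetP=> _ _ /imsetP[x _ ->] /imsetP[y _ ->] neq.
  apply/pred0P=> z /=; apply/negbTE; apply: contra neq => /andP[zx zy].
  by rewrite -(dcoset_eqP zx) -(dcoset_eqP zy).
- apply/imsetP=> -[x _ e]; have := mem_dcoset_id x.
  by rewrite -e inE.
Qed.

(** Left translation by [x^-1] turns KxL into [K :^ x * L], to which the product formula |AB| |A :&:
    B| = |A| |B| applies. *)
Lemma card_dcoset (x : gT) :
  #|K :* x * L| = (#|K| * #|L : (K :^ x :&: L)%G|)%N.
Proof.
have -> : K :* x * L = x *: (K :^ x * L).
  by rewrite conjsgE !mulgA mulg_set1 mulgV mul1g.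
rewrite card_lcoset; apply/eqP.
rewrite -(eqn_pmul2r (cardG_gt0 (K :^ x :&: L)%G)) -mul_cardG cardJg.
by rewrite -mulnA (mulnC #|L : _|) Lagrange ?subsetIr.
Qed.

(** Count [H] by its partition into double cosets, using [card_dcoset], and cancel [#|K|]. *)
Lemma sum_index_dcosets (X : {set gT}) :
    K \subset H -> L \subset H -> is_transversal X (dcosets K L H) H ->
  (\sum_(g in X) #|L : (K :^ g :&: L)%G|)%N = #|H : K|.
Proof.
move=> sKH sLH trX; have parH := dcosets_partition sKH sLH.
have /and3P[_ tiP _] := parH.
apply/eqP; rewrite -(eqn_pmul2l (cardG_gt0 K)) Lagrange // (card_partition parH).
rewrite -(pblock_transversal trX) big_imset /=; last exact: pblock_inj trX.
rewrite big_distrr /=; apply/eqP/eq_bigr => g Xg.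
rewrite -card_dcoset (@def_pblock _ _ (K :* g * L)) ?mem_dcoset_id //.
by apply: imset_f; apply: (subsetP (transversal_sub trX)).
Qed.

End DoubleCosets.

(** * Sylow indices and Bezout coefficients *)

Lemma gcdn_index_Sylows (gT : finGroupType) (G : {group gT}) (n : nat)
    (p : 'I_n -> nat) (P : 'I_n -> {group gT}) :
    (0 < n) -> {subset primes #|G| <= codom p} ->
    (forall i, (p i).-Sylow(G) (P i))%g ->
  \big[gcdn/0]_i #|G : P i|%g = 1.
Proof.
move=> n_gt0 p_all sylP; set d := \big[_/_]_i _.
have dvd_d i : d %| #|G : P i|%g by apply: (biggcdn_inf i).
(* The empty gcd is 0, which [n_gt0] excludes. *)
have d_gt0 : (0 < d) := dvdn_gt0 (indexg_gt0 _ _) (dvd_d (Ordinal n_gt0)).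
(* A prime dividing [d] would divide [#|G|], hence be some [p i], but the index of a Sylow
   [p i]-subgroup is prime to [p i]. *)
apply/eqP; rewrite eqn_leq d_gt0 andbT leqNgt; apply/negP=> d_gt1.
have q_pr := pdiv_prime d_gt1; set q := pdiv d in q_pr.
have q_dvd i : q %| #|G : P i|%g := dvdn_trans (pdiv_dvd d) (dvd_d i).
have /p_all/codomP[i Dq] : q \in primes #|G|.
  rewrite mem_primes q_pr cardG_gt0.
  exact: dvdn_trans (q_dvd (Ordinal n_gt0)) (dvdn_indexg _ _).
have /and3P[_ _ /(pnatPpi)/(_ _)] := sylP i.
move=> /(_ q); rewrite mem_primes q_pr indexg_gt0 q_dvd Dq => /(_ isT).
by rewrite !inE eqxx.
Qed.

Local Open Scope ring_scope.

(** Induction on [n]: apply Bezout to the first term and the gcd of the others, whose coefficients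
    get multiplied by [v]. *)
Lemma Bezout_sum (n : nat) (m : 'I_n -> nat) :
  exists a : 'I_n -> int,
    \sum_i a i * (m i)%:Z = (\big[gcdn/0%N]_i m i)%:Z.
Proof.
elim: n m => [|n IHn] m; first by exists (fun=> 0); rewrite !big_ord0.
have [b Db] := IHn (fun i => m (lift ord0 i)).
have [u [v Duv]] := Bezoutz (m ord0) (\big[gcdn/0%N]_i m (lift ord0 i)).
exists (fun i => if unlift ord0 i is Some j then v * b j else u).
rewrite !big_ord_recl unlift_none -[RHS]Duv -Db mulr_sumr; congr (_ + _).
by apply: eq_bigr => i _; rewrite liftK mulrA.
Qed.

(** * Additive structure of direct sums and of quotients *)

Section DirectSumTheory.
Variables (I : finType) (T : I -> zmodType).

Lemma dsumBE (u v : dsum T) (i : I) : (u - v) i = u i - v i.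
Proof. by rewrite [u - v]/(dsumD u (dsumN v)) !ffunE. Qed.

Lemma dsum_in_same (i : I) (x : T i) : dsum_in x i = x.
Proof. by rewrite ffunE dfwith_in. Qed.

Lemma dsum_in_diff (i j : I) (x : T i) : i != j -> dsum_in x j = 0.
Proof. by move=> ij; rewrite ffunE dfwith_out. Qed.

Fact dsum_in_is_zmod_morphism (i : I) : zmod_morphism (@dsum_in I T i).
Proof.
move=> x y; apply/ffunP=> j; rewrite dsumBE.
have [<-|ij] := eqVneq i j; first by rewrite !dsum_in_same.
by rewrite !dsum_in_diff // subrr.
Qed.

HB.instance Definition _ (i : I) :=
  GRing.isZmodMorphism.Build (T i) (dsum T) (@dsum_in I T i)
    (@dsum_in_is_zmod_morphism i).

(** Evaluation gets a name so that it can carry an additive structure and commute with sums. *)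
Definition dsum_proj (i : I) (u : dsum T) : T i := u i.

Fact dsum_proj_is_zmod_morphism (i : I) : zmod_morphism (@dsum_proj i).
Proof. by move=> u v; apply: dsumBE. Qed.

HB.instance Definition _ (i : I) :=
  GRing.isZmodMorphism.Build (dsum T) (T i) (@dsum_proj i)
    (@dsum_proj_is_zmod_morphism i).

Lemma dsum_sum (u : dsum T) : u = \sum_i dsum_in (u i).
Proof.
apply/ffunP=> j; rewrite -[RHS]/(dsum_proj j _) raddf_sum.
rewrite (bigD1 j) //= [dsum_proj _ _]dsum_in_same big1 ?addr0 // => i ij.
exact: dsum_in_diff.
Qed.

End DirectSumTheory.

Section QuotGen.
Variables (V : zmodType) (S : V -> Prop).

Definition quot_gen_pi (v : V) : quot_gen S := \pi_(quot_gen S)%qT v.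

Lemma quot_gen_piP (u v : V) :
  quot_gen_pi u = quot_gen_pi v <-> subgroup_gen S (u - v).
Proof.
split=> [/eqP|Suv]; first by rewrite -Quotient.idealrBE => /asboolP.
by apply/eqP; rewrite -Quotient.idealrBE; apply/asboolP.
Qed.

(** An arbitrary choice of representatives, not additive in general. *)
Definition quot_gen_repr (q : quot_gen S) : V := generic_quotient.repr q.

Lemma quot_gen_reprK : cancel quot_gen_repr quot_gen_pi.
Proof. by move=> q; apply: reprK. Qed.

Fact quot_gen_pi_is_zmod_morphism : zmod_morphism quot_gen_pi.
Proof. exact: pi_is_zmod_morphism. Qed.

HB.instance Definition _ :=
  GRing.isZmodMorphism.Build V (quot_gen S) quot_gen_pi
    quot_gen_pi_is_zmod_morphism.

End QuotGen.

(** * The transfer map and its inverse *)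

Section TransferIso.
Variables (gT : finGroupType) (G : {group gT}) (M : mackeyFunctor G).
Variables (n : nat) (P : 'I_n -> {group gT}).
Hypothesis sPG : forall i, P i \subset G.

Local Notation T := (fun i => M (P i) : zmodType).
Local Notation rel := (tr_conj_diff (M := M) (P := P)).
Local Notation cls := (@quot_gen_pi (dsum T) rel).

(** This is Phi before passage to the quotient. *)
Definition tr_sum (u : dsum T) : M G := \sum_i mtr M (P i) G (u i).

Fact tr_sum_is_zmod_morphism : zmod_morphism tr_sum.
Proof.
by move=> u v; rewrite -sumrB; apply: eq_bigr => i _; rewrite dsumBE raddfB.
Qed.

HB.instance Definition _ :=
  GRing.isZmodMorphism.Build (dsum T) (M G) tr_sum tr_sum_is_zmod_morphism.

Lemma tr_sum_dsum_in (i : 'I_n) (x : M (P i)) :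
  tr_sum (dsum_in (T := T) x) = mtr M (P i) G x.
Proof.
rewrite /tr_sum (bigD1 i) //= dsum_in_same big1 ?addr0 // => j ji.
by rewrite dsum_in_diff 1?eq_sym // raddf0.
Qed.

Lemma tr_sum_gen (u : dsum T) : subgroup_gen rel u -> tr_sum u = 0.
Proof.
elim=> {u} [_ [i [j [H [H' [g [x [sHP Gg DH' sH'P ->]]]]]]]||u v _ u0 _ v0].
- rewrite raddfB /= !tr_sum_dsum_in !mtr_comp //.
  have sHG := subset_trans sHP (sPG i).
  (* Since [g] normalizes [G], [mconj_tr] applies with [G] as both targets, and [c_g] is trivial
     there. *)
  have DG : G :=: (G :^ g^-1)%g by rewrite conjGid ?groupV.
  by rewrite -(mconj_tr sHG (subxx G) Gg DH' DG) mconj_id ?subrr.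
- exact: raddf0.
- by rewrite raddfB /= u0 v0 subrr.
Qed.

Hypothesis cohM : cohomological M.

Lemma cls_res_tr (i j : 'I_n) (x : M (P j)) :
  cls (dsum_in (T := T) (mres M G (P i) (mtr M (P j) G x)))
    = cls (dsum_in (T := T) x) *+ #|G : P i|%g.
Proof.
have parG := dcosets_partition (sPG i) (sPG j).
have trX := transversalP parG; set X := transversal _ _ in trX.
rewrite (mdouble_coset (sPG i) (sPG j) (subxx G) trX) !raddf_sum /=.
rewrite -(sum_index_dcosets (sPG i) (sPG j) trX) -sumrMnr.
apply: eq_bigr => g Xg.
have Gg : g \in G := subsetP (transversal_sub trX) g Xg.
have sIP : (P i :^ g :&: P j)%G \subset P j by apply: subsetIr.
(* The index multiple of [x] becomes Tr R x, one side of a relation from summand [j] to summand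
   [i]. *)
rewrite -!raddfMn /= -(cohM sIP (sPG j)).
apply/esym/quot_gen_piP/subgroup_gen_in.
exists j, i, (P i :^ g :&: P j)%G, (P i :&: P j :^ g^-1)%G, g.
exists (mres M (P j) (P i :^ g :&: P j)%G x); split=> //; last exact: subsetIl.
by rewrite /= conjIg conjsgK.
Qed.

Variable a : 'I_n -> int.
Hypothesis sum_a : \sum_i a i * (#|G : P i|%g)%:Z = 1.

(** This is Psi, with values taken directly in the quotient. *)
Definition res_comb (y : M G) : quot_gen rel :=
  \sum_i cls (dsum_in (T := T) (mres M G (P i) y)) *~ a i.

Fact res_comb_is_zmod_morphism : zmod_morphism res_comb.
Proof.
by move=> y z; rewrite -sumrB; apply: eq_bigr => i _; rewrite !raddfB mulrzBl.
Qed.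

HB.instance Definition _ :=
  GRing.isZmodMorphism.Build (M G) (quot_gen rel) res_comb
    res_comb_is_zmod_morphism.

Lemma mulrz_index_sum (V : zmodType) (x : V) :
  \sum_i x *+ #|G : P i|%g *~ a i = x.
Proof.
rewrite -[RHS]mulr1z -sum_a mulrz_sumr; apply: eq_bigr => i _.
by rewrite pmulrn -mulrzA mulrC.
Qed.

Lemma res_combK : cancel res_comb (fun q => tr_sum (quot_gen_repr q)).
Proof.
move=> y; pose u := \sum_i dsum_in (T := T) (mres M G (P i) y) *~ a i.
have -> : res_comb y = cls u.
  by rewrite raddf_sum; apply: eq_bigr => i _; rewrite raddfMz.
(* The chosen representative differs from [u] by an element of the relation subgroup, which [tr_sum]
   kills. *)
have /quot_gen_piP/tr_sum_gen/eqP : cls (quot_gen_repr (cls u)) = cls u.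
  exact: quot_gen_reprK.
rewrite raddfB subr_eq0 => /eqP->; rewrite raddf_sum -[RHS]mulrz_index_sum.
by apply: eq_bigr => i _; rewrite raddfMz /= tr_sum_dsum_in cohM.
Qed.

(** By additivity it suffices to treat one summand, where [cls_res_tr] and the Bezout identity
    conclude. *)
Lemma res_comb_tr_sum (u : dsum T) : res_comb (tr_sum u) = cls u.
Proof.
rewrite [in RHS](dsum_sum u) !raddf_sum; apply: eq_bigr => j _ /=.
rewrite -[RHS]mulrz_index_sum.
by apply: eq_bigr => i _; rewrite cls_res_tr.
Qed.

Lemma res_comb_bij : bijective res_comb.
Proof.
exists (fun q => tr_sum (quot_gen_repr q)); first exact: res_combK.
by move=> q; rewrite res_comb_tr_sum; apply: quot_gen_reprK.
Qed.

End TransferIso.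

Local Close Scope ring_scope.

Theorem theorem3p1 (gT : finGroupType) (G : {group gT}) (n : nat)
    (p : 'I_n -> nat) (P : 'I_n -> {group gT}) (M : mackeyFunctor G) :
  0 < n ->
  perm_eq (codom p) (primes #|G|) ->
  (forall i : 'I_n, (p i).-Sylow(G) (P i))%g ->
  cohomological M ->
  exists f : {additive M G -> quot_gen (tr_conj_diff (M := M) (P := P))},
    bijective f.
Proof.
move=> n_gt0 /perm_mem p_all sylP cohM.
have sPG i : P i \subset G := pHall_sub (sylP i).
have [a] := Bezout_sum (fun i => #|G : P i|%g).
rewrite (gcdn_index_Sylows n_gt0 _ sylP) => [sum_a|q]; last by rewrite p_all.
(* The isomorphism given is Psi, whose definition involves no choice of representatives. *)
by exists (@res_comb _ G M n P a); exact: (res_comb_bij sPG cohM sum_a).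
Qed.
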